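(* Suppose $E:\mathcal{P}_{2,\omega_0}(\mathbb{R}^d)\to\mathbb{R}\cup\{+\infty\}$ is proper, coercive, lower semicontinuous and $\lambda$-convex along generalized geodesics for some $\lambda\in\mathbb{R}$, and let $\mu\in D(|\partial E|)$, $\nu\in\overline{D(E)}$. Then for all $0<\tau<\frac1{\lambda^-}$: if $\lambda>0$, $(1+\lambda\tau)^2W_2^2(J_\tau\mu,J_\tau\nu)\le W_2^2(\mu,\nu)+\tau^2|\partial E|^2(\mu)+2\lambda\tau^2[E(\nu)-\inf E]$; if $\lambda\le0$, $(1+\lambda\tau)^2W_2^2(J_\tau\mu,J_\tau\nu)\le W_2^2(\mu,\nu)+\tau^2|\partial E|^2(\mu)$.
   Context: Fix a probability measure $\omega_0$ on $\mathbb{R}^d$. $W_2$ is the quadratic Wasserstein distance, $\Gamma_0(\mu,\nu)$ the optimal couplings; $\mathcal{P}_{2,\omega_0}(\mathbb{R}^d)=\{\mu:W_2(\mu,\omega_0)<\infty\}$. A transport plan from $\mu_0$ to $\mu_1$ with base $\omega$ is $\boldsymbol\omega\in\mathcal{P}((\mathbb{R}^d)^3)$ with $\pi^{1,2}\#\boldsymbol\omega\in\Gamma_0(\omega,\mu_0)$, $\pi^{1,3}\#\boldsymbol\omega\in\Gamma_0(\omega,\mu_1)$; generalized geodesic $\mu_\alpha=((1-\alpha)\pi^2+\alpha\pi^3)\#\boldsymbol\omega$; $W_{2,\boldsymbol\omega}(\mu_0,\mu_1)=(\int|x_2-x_3|^2d\boldsymbol\omega)^{1/2}$. $D(E)=\{E<\infty\}$;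 proper: $D(E)\ne\emptyset$; coercive: $\exists\tau_0>0,u_0$ with $\inf_v\{\frac1{2\tau_0}W_2^2(u_0,v)+E(v)\}>-\infty$; lower semicontinuous w.r.t. $W_2$; $\lambda$-convex along generalized geodesics: for all $\mu_0,\mu_1,\omega$ there is a generalized geodesic from $\mu_0$ to $\mu_1$ with base $\omega$ (induced by some $\boldsymbol\omega$) with $E(\mu_\alpha)\le(1-\alpha)E(\mu_0)+\alpha E(\mu_1)-\alpha(1-\alpha)\frac\lambda2W^2_{2,\boldsymbol\omega}(\mu_0,\mu_1)$. $\lambda^-=\max\{0,-\lambda\}$, $1/\lambda^-=+\infty$ if $\lambda^-=0$; $\overline{D(E)}$ is the $W_2$-closure. $J_\tau\mu=\operatorname{argmin}_\nu\{\frac1{2\tau}W_2^2(\mu,\nu)+E(\nu)\}$ (well defined for $\mu\in\overline{D(E)}$, $0<\tau<1/\lambda^-$). Metric slope $|\partial E|(\mu)=\limsup_{\nu\to\mu}(E(\mu)-E(\nu))^+/W_2(\mu,\nu)$; $D(|\partial E|)=\{\mu\in D(E):|\partial E|(\mu)<\infty\}$. *)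

(* Defs.v *)
From HB Require Import structures.
From mathcomp Require Import all_boot all_order all_algebra.
From mathcomp Require Import all_classical all_reals all_analysis.
Set Implicit Arguments. Unset Strict Implicit. Unset Printing Implicit Defensive.
Import Order.TTheory GRing.Theory Num.Theory.
Import numFieldNormedType.Exports.
Local Open Scope classical_set_scope.
Local Open Scope ring_scope.

Section Wasserstein.
Variables (R : realType) (d : nat).

(* R^d as row vectors, equipped with its Borel sigma-algebra
   (generated by the open sets of the product topology = Euclidean topology). *)
Definition Rd : Type := g_sigma_algebraType (@open ('rV[R]_d)).
HB.instance Definition _ := Measurable.on Rd.

Definition sqd (x y : 'rV[R]_d) : R := \sum_(i < d) (x ord0 i - y ord0 i) ^+ 2.

Local Open Scope ereal_scope.

Definition is_coupling {dU} {U : measurableType dU} (P : probability U R)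
  (f g : U -> Rd) (mu nu : probability Rd R) : Prop :=
  [/\ measurable_fun setT f, measurable_fun setT g,
      (forall A : set Rd, measurable A -> P (f @^-1` A) = mu A) &
      (forall A : set Rd, measurable A -> P (g @^-1` A) = nu A)].

Definition cost {dU} {U : measurableType dU} (P : probability U R)
  (f g : U -> Rd) : \bar R :=
  \int[P]_u (sqd (f u) (g u))%:E.

Definition W2sq (mu nu : probability Rd R) : \bar R :=
  ereal_inf [set cost P fst snd | P in
     [set P : probability (Rd * Rd)%type R | is_coupling P fst snd mu nu]].

Definition W2 (mu nu : probability Rd R) : \bar R := sqrte (W2sq mu nu).

Definition optimal_via {dU} {U : measurableType dU} (P : probability U R)
  (f g : U -> Rd) (mu nu : probability Rd R) : Prop :=
  is_coupling P f g mu nu /\ cost P f g = W2sq mu nu.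

Definition P2 (omega0 : probability Rd R) : set (probability Rd R) :=
  [set mu | W2 mu omega0 < +oo].

Variables (omega0 : probability Rd R) (E : probability Rd R -> \bar R).

Definition no_minus_infty : Prop := forall mu, P2 omega0 mu -> E mu != -oo.

Definition domE : set (probability Rd R) :=
  [set mu | P2 omega0 mu /\ E mu < +oo].

Definition E_proper : Prop := exists mu, domE mu.

Definition E_coercive : Prop :=
  exists tau0 : R, (0 < tau0)%R /\ exists u0, P2 omega0 u0 /\
    -oo < ereal_inf [set ((2 * tau0)^-1)%:E * W2sq u0 v + E v | v in P2 omega0].

Definition W2_lsc : Prop :=
  forall mu, P2 omega0 mu -> forall c : R, c%:E < E mu ->
    exists delta : R, (0 < delta)%R /\
      forall nu, P2 omega0 nu -> W2 mu nu < delta%:E -> c%:E < E nu.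

Definition gg_convex (lam : R) : Prop :=
  forall mu0 mu1 w, P2 omega0 mu0 -> P2 omega0 mu1 -> P2 omega0 w ->
  exists W : probability (Rd * Rd * Rd)%type R,
    [/\ optimal_via W (fun x => x.1.1) (fun x => x.1.2) w mu0,
        optimal_via W (fun x => x.1.1) (fun x => x.2) w mu1 &
        forall alpha : R, (0 <= alpha <= 1)%R ->
        forall mua : probability Rd R,
          (forall A : set Rd, measurable A ->
             mua A = W ((fun x : Rd * Rd * Rd =>
                 ((1 - alpha) *: (x.1.2 : 'rV[R]_d) + alpha *: (x.2 : 'rV[R]_d))%R
                   : Rd) @^-1` A)) ->
          E mua <= ((1 - alpha)%R)%:E * E mu0 + alpha%:E * E mu1
                   - (alpha * (1 - alpha) * lam / 2)%:E
                     * cost W (fun x => x.1.2) (fun x => x.2)].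

Definition closure_domE : set (probability Rd R) :=
  [set nu | P2 omega0 nu /\ forall eps : R, (0 < eps)%R ->
      exists nu', domE nu' /\ W2 nu nu' < eps%:E].

(* metric slope: limsup_{nu -> mu} (E mu - E nu)^+ / W2(mu, nu),
   i.e. inf_{r > 0} sup_{0 < W2(mu,nu) < r} ... (with the value 0 for
   an isolated point) *)
Definition metric_slope (mu : probability Rd R) : \bar R :=
  ereal_inf [set ereal_sup ([set 0] `|`
     [set maxe (E mu - E nu) 0 * ((fine (W2 mu nu))^-1)%:E
        | nu in [set nu | P2 omega0 nu /\ 0 < W2 mu nu < r%:E]])
   | r in [set r : R | (0 < r)%R]].

Definition dom_slope : set (probability Rd R) :=
  [set mu | domE mu /\ metric_slope mu < +oo].

Definition is_JKO (tau : R) (mu m : probability Rd R) : Prop :=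
  P2 omega0 m /\ forall v, P2 omega0 v ->
    ((2 * tau)^-1)%:E * W2sq mu m + E m <= ((2 * tau)^-1)%:E * W2sq mu v + E v.

Definition infE : \bar R := ereal_inf [set E v | v in P2 omega0].

End Wasserstein.

(* 1 / lambda^- in \bar R, with 1/0 = +oo *)
Definition inv_lambda_minus (R : realType) (lam : R) : \bar R :=
  if (0 <= lam)%R then +oo%E else ((- lam)^-1)%:E.

(* Main.v *)
(** Write W for the Wasserstein distance, S for the slope at mu, k = 1 + lam tau.
    Comparing a minimizer Jmu with the generalized geodesic of base mu joining it
    to v gives the discrete variational inequality
      k W(Jmu, v)^2 <= W(mu, v)^2 - W(mu, Jmu)^2 + 2 tau (E v - E Jmu).
    It is used for (mu, v = Jnu) and for (nu, v = mu), together with the bound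
    E mu - E v <= S W(mu, v) - (lam / 2) W(mu, v)^2.  For lam > 0, k times
    the first inequality plus the second one suffices.  For lam <= 0 the energy
    difference between mu and Jnu is eliminated with the second inequality, and
    what is left is absorbed by
      k (1 - k) W(mu, Jnu)^2 <= (1 - k) W(mu, nu)^2 + k W(nu, Jnu)^2.
    The three-plans provided by the convexity hypothesis stand in for the gluing
    lemma, except to see that the points of a generalized geodesic stay at finite
    distance from omega0. *)
Require Import Defs.
From HB Require Import structures.
From mathcomp Require Import all_boot all_order all_algebra.
From mathcomp Require Import all_classical all_reals all_analysis.
From mathcomp Require Import measurable_realfun ring lra.
Import Order.TTheory GRing.Theory Num.Theory.
Import numFieldNormedType.Exports.
Local Open Scope classical_set_scope.
Local Open Scope ring_scope.

(** * Borel measurability in coordinates and squared Euclidean distance *)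

Section borel_Rd.
Context {R : realType} {d : nat}.
Local Notation Rd := (Rd R d).

Definition box (c : 'rV[R]_d) (r : R) : set Rd :=
  [set x : 'rV[R]_d | forall i, `|x ord0 i - c ord0 i| < r].

Lemma measurable_coord (i : 'I_d) :
  measurable_fun setT (fun x : Rd => (x : 'rV[R]_d) ord0 i).
Proof.
apply: (measurability _ (RGenOpens.measurableE R)).
move=> _ [_ [a [b ->]] <-]; rewrite setTI; apply: sub_sigma_algebra.
apply: (open_comp (f := fun x : 'rV[R]_d => x ord0 i)) => [x _|].
  exact: coord_continuous.
exact: interval_open.
Qed.

Lemma measurable_box_preimage {dU} {U : measurableType dU} (f : U -> Rd) c r :
  (forall i, measurable_fun setT (fun u => (f u : 'rV[R]_d) ord0 i)) ->
  measurable (f @^-1` box c r).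
Proof.
move=> mf.
have -> : f @^-1` box c r = \bigcap_(i in [set: 'I_d])
    ((fun u => (f u : 'rV[R]_d) ord0 i) @^-1` ball (c ord0 i) r).
  apply/seteqP; split=> u /=.
    by move=> fu i _ /=; rewrite -ball_normE /= distrC.
  by move=> fu i; have := fu i I; rewrite /= -ball_normE /= distrC.
apply: fin_bigcap_measurable; first exact: finite_finset.
move=> i _; rewrite -[X in measurable X]setTI; apply: mf => //.
by apply: open_measurable; exact: ball_open.
Qed.

Lemma ratvec_in_box (x : 'rV[R]_d) (e : R) : 0 < e ->
  exists q : 'rV[rat]_d, box (map_mx ratr q) e x.
Proof.
move=> e0.
have /choice[q xq] i : exists q : rat, `|x ord0 i - ratr q| < e.
  have [q] := @rat_in_itvoo R (x ord0 i - e) (x ord0 i + e) ltac:(lra).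
  rewrite in_itv /= => /andP[h1 h2]; exists q; rewrite ltr_norml.
  by apply/andP; split; lra.
by exists (\row_i q i) => i; rewrite !mxE.
Qed.

(** Second countability. The inclusion in [O] is put inside the indexed set so that the union runs
    over a countable type. *)
Lemma open_bigcup_box (O : set 'rV[R]_d) : open O ->
  O = \bigcup_(p : 'rV[rat]_d * nat)
        [set x | box (map_mx ratr p.1) p.2.+1%:R^-1 x /\
                 box (map_mx ratr p.1) p.2.+1%:R^-1 `<=` O].
Proof.
move=> oO; apply/seteqP; split=> [x Ox|x [p _ [xp +]]]; last exact.
have /nbhs_ballP[e /= e0 xeO] := open_nbhs_nbhs (conj oO Ox).
(* A radius below [e / 2]: a box around [q] containing [x] then stays within [e] of [x]. *)
pose n := Num.truncn (2 / e).
have n0 : 0 < n.+1%:R^-1 :> R by rewrite invr_gt0.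
have ne : n.+1%:R^-1 < e / 2.
  rewrite -[ltRHS]invrK ltf_pV2 ?posrE// ?invr_gt0 ?divr_gt0//.
  by rewrite invf_div truncnS_gt.
have [q xq] := ratvec_in_box x _ n0.
exists (q, n) => //; split=> // y yq; apply: xeO.

split=> // i j; rewrite (_ : i = ord0) ?ord1// -ball_normE /=.
rewrite (le_lt_trans (ler_distD (ratr (q ord0 j)) _ _))// [ltRHS]splitr.
move: (xq j) (yq j); rewrite !mxE [in X in _ -> X -> _]distrC => xqj yqj.
by rewrite ltrD// (lt_trans _ ne).
Qed.

(** The sigma-algebra is generated by open sets, not by coordinates; countable unions of rational
    boxes bridge the two. *)
Lemma measurable_fun_Rd {dU} {U : measurableType dU} (f : U -> Rd) :
  (forall i, measurable_fun setT (fun u => (f u : 'rV[R]_d) ord0 i)) ->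
  measurable_fun setT f.
Proof.
move=> mf; apply: (@measurability _ _ U Rd setT f (@open 'rV[R]_d)) => //.
move=> _ [V oV <-]; rewrite setTI (open_bigcup_box _ oV) preimage_bigcup.
apply: countable_bigcupT_measurable; first exact: countableP.
move=> p; have [pV|pV] := pselect (box (map_mx ratr p.1) p.2.+1%:R^-1 `<=` V).
  have -> : [set x | box (map_mx ratr p.1) p.2.+1%:R^-1 x /\
      box (map_mx ratr p.1) p.2.+1%:R^-1 `<=` V] =
      box (map_mx ratr p.1) p.2.+1%:R^-1.
    by apply/seteqP; split=> x /= => [[]|].
  exact: measurable_box_preimage.
rewrite [X in measurable X](_ : _ = set0) //.
by rewrite -subset0 => x /= [].
Qed.

Lemma measurable_fun_coord {dU} {U : measurableType dU} (f : U -> Rd) i :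
  measurable_fun setT f ->
  measurable_fun setT (fun u => (f u : 'rV[R]_d) ord0 i).
Proof. by move=> mf; apply: (measurableT_comp (measurable_coord i)). Qed.

Lemma measurable_sqd {dU} {U : measurableType dU} (f g : U -> Rd) :
  measurable_fun setT f -> measurable_fun setT g ->
  measurable_fun setT (fun u => sqd (f u) (g u)).
Proof.
move=> mf mg; apply: measurable_sum => i; apply: measurable_funX.
by apply: measurable_funB; exact: measurable_fun_coord.
Qed.

Lemma measurable_interp {dU} {U : measurableType dU} (f g : U -> Rd) (a b : R) :
  measurable_fun setT f -> measurable_fun setT g ->
  measurable_fun setT
    (fun u => a *: (f u : 'rV[R]_d) + b *: (g u : 'rV[R]_d) : Rd).
Proof.
move=> mf mg; apply: measurable_fun_Rd => i.
under eq_fun do rewrite !mxE.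
by apply: measurable_funD; apply: measurable_funM => //;
  exact: measurable_fun_coord.
Qed.

Lemma sqd_ge0 (x y : 'rV[R]_d) : 0 <= sqd x y.
Proof. by apply: sumr_ge0 => i _; exact: sqr_ge0. Qed.

Lemma sqdC (x y : 'rV[R]_d) : sqd x y = sqd y x.
Proof. by apply: eq_bigr => i _; rewrite -sqrrN opprB. Qed.

Lemma sqdxx (x : 'rV[R]_d) : sqd x x = 0.
Proof. by apply: big1 => i _; rewrite subrr expr0n. Qed.

(** Hilbert space identity behind the 1-convexity of half the squared distance along generalized
    geodesics. *)
Lemma sqd_interp (x y z : 'rV[R]_d) (a : R) :
  sqd x ((1 - a) *: y + a *: z) + a * (1 - a) * sqd y z =
  (1 - a) * sqd x y + a * sqd x z.
Proof.
rewrite /sqd !mulr_sumr -!big_split /=; apply: eq_bigr => i _.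
by rewrite !mxE; ring.
Qed.

Lemma sqd_le2 (x y z : 'rV[R]_d) : sqd x z <= 2 * sqd x y + 2 * sqd y z.
Proof.
rewrite /sqd !mulr_sumr -!big_split /=; apply: ler_sum => i _.
rewrite -subr_ge0 (_ : _ - _ = (x ord0 i - y ord0 i - (y ord0 i - z ord0 i)) ^+ 2).
  exact: sqr_ge0.
by ring.
Qed.

Lemma sqd_box (x c : 'rV[R]_d) : box c 1 x -> sqd x c <= d%:R.
Proof.
move=> xc; rewrite -[leRHS]mulr1 mulr_natl -[X in _ *+ X]card_ord -sumr_const.
apply: ler_sum => i _; rewrite -real_normK ?num_real// exprn_ile1//.
exact/ltW/xc.
Qed.

(** Enumerate the unit boxes with rational centres and remove from each the earlier ones. Numbers
    that code no vector repeat the box at 0, which is harmless. *)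
Lemma bounded_partition : exists (D : (set Rd)^nat) (c : nat -> 'rV[R]_d),
  [/\ forall n, measurable (D n), trivIset setT D, \bigcup_n D n = setT &
      forall n x, D n x -> sqd x (c n) <= d%:R].
Proof.
pose c n : 'rV[R]_d := if unpickle n is Some q then map_mx ratr (q : 'rV[rat]_d) else 0.
exists (seqDU (fun n => box (c n) 1)), c; split.
- apply: seqDU_measurable => n.
  by apply: (measurable_box_preimage id) => i; exact: measurable_coord.
- exact: trivIset_seqDU.
- rewrite -seqDU_bigcup_eq -subTset => x _.
  have [q xq] := ratvec_in_box x _ ltr01.
  by exists (pickle q) => //; rewrite /c pickleK.
- by move=> n x nx; apply: sqd_box; apply: subset_seqDU nx.
Qed.

End borel_Rd.

(** * Image laws and conditional laws *)

Section image_probability.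
Context {dU dV : measure_display} {U : measurableType dU} {V : measurableType dV}
  {R : realType}.
Local Open Scope ereal_scope.

Lemma exists_law (P : probability U R) (f : U -> V) : measurable_fun setT f ->
  exists N : probability V R, forall A, N A = P (f @^-1` A).
Proof.
move=> mf.
pose X : {mfun U >-> V} := HB.pack f (isMeasurableFun.Build _ _ _ _ f mf).
by exists (distribution P X).
Qed.

Lemma ge0_integral_mrestr (m : {measure set U -> \bar R}) (B : set U)
    (mB : measurable B) (h : U -> \bar R) :
  measurable_fun setT h -> (forall u, 0 <= h u) ->
  \int[mrestr m mB]_u h u = \int[m]_(u in B) h u.
Proof.
move=> mh h0.
have mCB : measurable (~` B) by exact: measurableC.
rewrite -(setUv B) ge0_integral_setU ?setUv//=; last exact/disj_setPCl.
rewrite [X in _ + X]null_set_integral ?adde0//; last 2 first.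
- exact: measurable_funTS.
- by rewrite /= /mrestr setICl measure0.
by apply: eq_measure_integral => A mA AB; rewrite /= /mrestr setIidl.
Qed.

(** Law of [f] given [B], in product form so that it also makes sense for a null [B], where any law
    of total mass 1 will do. *)
Lemma exists_cond_law (P : probability U R) (B : set U) (f : U -> V) :
  measurable B -> measurable_fun setT f ->
  exists N : probability V R,
    forall A, measurable A -> P B * N A = P (f @^-1` A `&` B).
Proof.
move=> mB mf; have [PB0|PB0] := eqVneq (P B) 0.
  have [N PN] := exists_law P f mf; exists N => A mA.
  rewrite PB0 mul0e; apply/esym/(@subset_measure0 _ _ _ P _ B) => //.
  by apply: measurableI => //; rewrite -[X in measurable X]setTI; exact: mf.
have [N PN] := exists_law (mnormalize (mrestr P mB) P) f mf.
exists N => A mA.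
rewrite PN /= /mnormalize /= /mrestr setTI (negbTE PB0) /=.
have PBfin : P B \is a fin_num by exact: fin_num_measure.
have -> : (P B == +oo) = false by apply/eqP => PBoo; rewrite PBoo in PBfin.
by rewrite muleCA -{1}(fineK PBfin) -EFinM divff ?mule1// fine_eq0.
Qed.

(** Both sides integrate [g] against the image under [f] of [P] restricted to [B]. *)
Lemma cond_law_integral (P : probability U R) (B : set U) (f : U -> V)
    (N : probability V R) :
  measurable B -> measurable_fun setT f ->
  (forall A, measurable A -> P B * N A = P (f @^-1` A `&` B)) ->
  forall g : V -> \bar R, measurable_fun setT g -> (forall v, 0 <= g v) ->
  P B * \int[N]_v g v = \int[P]_(u in B) g (f u).
Proof.
move=> mB mf PN g mg g0.
have PBfin : P B \is a fin_num by exact: fin_num_measure.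
have k0 : (0 <= fine (P B))%R by exact/fine_ge0/measure_ge0.
rewrite -(fineK PBfin).
rewrite -(@ge0_integral_mscale _ _ _ N setT measurableT (NngNum k0))//.
rewrite (@eq_measure_integral _ _ _ _ (pushforward (mrestr P mB) f)); last first.
  by move=> A mA _; rewrite /= /mscale /= fineK// PN.
rewrite ge0_integral_pushforward//= preimage_setT ge0_integral_mrestr//.
exact: measurableT_comp.
Qed.

Lemma law_integral (P : probability U R) (f : U -> V) (N : probability V R) :
  measurable_fun setT f -> (forall A, measurable A -> N A = P (f @^-1` A)) ->
  forall g : V -> \bar R, measurable_fun setT g -> (forall v, 0 <= g v) ->
  \int[N]_v g v = \int[P]_u g (f u).
Proof.
move=> mf PN g mg g0.
rewrite -(@cond_law_integral P setT f N)//.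
- by rewrite -[LHS]mul1e; congr (_ * _); rewrite probability_setT.
- by move=> A mA; rewrite probability_setT mul1e setIT PN.
Qed.

End image_probability.

(** * Transport cost and elementary properties of the Wasserstein distance *)

Section W2_basics.
Context {R : realType} {d : nat}.
Local Notation Rd := (Rd R d).
Implicit Types mu nu rho sigma eta : probability Rd R.
Local Open Scope ereal_scope.

Lemma measurable_sqdE {dU} {U : measurableType dU} (f g : U -> Rd) :
  measurable_fun setT f -> measurable_fun setT g ->
  measurable_fun setT (fun u => (sqd (f u) (g u))%:E).
Proof. by move=> mf mg; apply/measurable_EFinP/measurable_sqd. Qed.

Section cost.
Context {dU : measure_display} {U : measurableType dU}.
Context (P : probability U R).
Implicit Types f g h : U -> Rd.

Lemma cost_ge0 f g : 0 <= cost P f g.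
Proof. by apply: integral_ge0 => u _; rewrite lee_fin sqd_ge0. Qed.

Lemma costC f g : cost P f g = cost P g f.
Proof. by apply: eq_integral => u _; rewrite sqdC. Qed.

(** Integrated form of [sqd_interp]. Having only sums of nonnegative terms, it needs no
    integrability. *)
Lemma cost_interp f g h (a : R) : (0 <= a <= 1)%R ->
  measurable_fun setT f -> measurable_fun setT g -> measurable_fun setT h ->
  cost P f (fun u => (1 - a) *: (g u : 'rV[R]_d) + a *: (h u : 'rV[R]_d))%R
    + (a * (1 - a))%:E * cost P g h
  = (1 - a)%:E * cost P f g + a%:E * cost P f h.
Proof.
move=> /andP[a0 a1] mf mg mh; have a1' : (0 <= 1 - a)%R by rewrite subr_ge0.
have mi := measurable_interp g h (1 - a) a mg mh.
have ge0 (k : R) (u v : U -> Rd) : (0 <= k)%R ->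
    forall x : U, setT x -> 0 <= k%:E * (sqd (u x) (v x))%:E.
  by move=> k0 x _; rewrite -EFinM lee_fin mulr_ge0// sqd_ge0.
have s0 (u v : U -> Rd) x : setT x -> 0 <= (sqd (u x) (v x))%:E.
  by move=> _; rewrite lee_fin sqd_ge0.
have mk (k : R) (u v : U -> Rd) : measurable_fun setT u ->
    measurable_fun setT v ->
    measurable_fun setT (fun x => k%:E * (sqd (u x) (v x))%:E).
  by move=> mu mv; apply: measurable_funeM; exact: measurable_sqdE.
rewrite /cost -!ge0_integralZl_EFin//; try exact: measurable_sqdE; try exact: s0.
  rewrite -!ge0_integralD//; try exact: mk; try exact: measurable_sqdE;
    try (apply: ge0; by rewrite ?mulr_ge0); try exact: s0.
  by apply: eq_integral => u _; rewrite -!EFinM -!EFinD sqd_interp.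
exact: mulr_ge0.
Qed.

(** The cost depends only on the joint law of [f] and [g], which is an admissible plan; this allows
    couplings carried by a three-plan. *)
Lemma W2sq_le f g mu nu : is_coupling P f g mu nu ->
  W2sq mu nu <= cost P f g.
Proof.
move=> [mf mg Pf Pg].
have mfg : measurable_fun setT (fun u => (f u, g u)) by exact: measurable_fun_pair.
have [N PN] := exists_law P _ mfg.
apply: ereal_inf_lbound; exists N; first split => // A mA.
- by rewrite PN -Pf.
- by rewrite PN -Pg.
- rewrite /cost (law_integral P _ N mfg (fun A _ => PN A))//.
    exact: measurable_sqdE.
  by move=> v; rewrite lee_fin sqd_ge0.
Qed.

End cost.

Lemma W2sq_ge0 mu nu : 0 <= W2sq mu nu.
Proof. by apply: le_ereal_inf_tmp => _ [P _ <-]; exact: cost_ge0. Qed.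

Lemma W2sqC_le mu nu : W2sq mu nu <= W2sq nu mu.
Proof.
apply: le_ereal_inf_tmp => _ [P [m1 m2 P1 P2] <-].
by rewrite costC; apply: W2sq_le.
Qed.

Lemma W2sqC mu nu : W2sq mu nu = W2sq nu mu.
Proof. by apply/eqP; rewrite eq_le !W2sqC_le. Qed.

Lemma W2sqxx mu : W2sq mu mu = 0.
Proof.
apply/eqP; rewrite eq_le W2sq_ge0 andbT.
apply: le_trans (W2sq_le mu id id mu mu _) _ => //.
by rewrite /cost (eq_integral (cst 0)) ?integral0// => u _; rewrite sqdxx.
Qed.

Lemma P2P (omega0 mu : probability Rd R) : P2 omega0 mu <-> W2sq mu omega0 < +oo.
Proof.
have h0 := W2sq_ge0 mu omega0.
rewrite /P2 /= /W2 -!ge0_fin_numE ?sqrte_ge0//.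
by rewrite sqrte_fin_num.
Qed.

End W2_basics.

(** * Finiteness of the distance is transitive *)

Section approximate_gluing.
Context {R : realType} {d : nat}.
Local Notation Rd := (Rd R d).
Local Open Scope ereal_scope.

Lemma product_probability_fst {d1 d2} {T1 : measurableType d1}
    {T2 : measurableType d2} (P : probability T1 R) (Q : probability T2 R)
    (A : set T1) : measurable A -> (P \x Q) (fst @^-1` A) = P A.
Proof.
move=> mA; rewrite -setXT product_measure1E// -[RHS]mule1; congr (_ * _).
exact: probability_setT.
Qed.

Lemma product_probability_snd {d1 d2} {T1 : measurableType d1}
    {T2 : measurableType d2} (P : probability T1 R) (Q : probability T2 R)
    (A : set T2) : measurable A -> (P \x Q) (snd @^-1` A) = Q A.
Proof.
move=> mA; rewrite -setTX product_measure1E// -[RHS]mul1e; congr (_ * _).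
exact: probability_setT.
Qed.

Lemma sum_cond_measure {dU} {U : measurableType dU} (P : probability U R)
    (f : U -> Rd) (D : (set Rd)^nat) (A : set U) : measurable_fun setT f ->
  (forall n, measurable (D n)) -> trivIset setT D -> \bigcup_n D n = setT ->
  measurable A -> \sum_(n <oo) P (A `&` f @^-1` D n) = P A.
Proof.
move=> mf mD tD cD mA.
have mF n : measurable (A `&` f @^-1` D n).
  by apply: measurableI => //; rewrite -[X in measurable X]setTI; exact: mf.
rewrite -measure_semi_bigcup//.
- by rewrite -setI_bigcupr -preimage_bigcup cD preimage_setT setIT.
- apply: trivIset_setIl; apply/trivIsetP => i j _ _ ij.
  by move/trivIsetP : tD => /(_ i j I I ij) tD; rewrite -preimage_setI tD preimage_set0.
- exact: bigcup_measurable.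
Qed.

(** Replacing [g] by the centre of its cell costs a constant: on each cell the integrand is at most
    [4 * sqd f g + 4 * d], and the cells partition the space. *)
Lemma sum_cond_cost_lty {dU} {U : measurableType dU} (P : probability U R)
    (f g : U -> Rd) (D : (set Rd)^nat) (c : nat -> 'rV[R]_d) :
  measurable_fun setT f -> measurable_fun setT g -> cost P f g < +oo ->
  (forall n, measurable (D n)) -> trivIset setT D -> \bigcup_n D n = setT ->
  (forall n x, D n x -> (sqd x (c n) <= d%:R)%R) ->
  \sum_(n <oo) \int[P]_(u in g @^-1` D n) (2 * sqd (f u) (c n))%:E < +oo.
Proof.
move=> mf mg Pfg mD tD cD Dc.
have mF n : measurable (g @^-1` D n).
  by rewrite -[X in measurable X]setTI; exact: mg.
pose h u := (4 * sqd (f u) (g u) + 4 * d%:R)%:E.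
have h0 u : 0 <= h u by rewrite lee_fin addr_ge0// mulr_ge0// sqd_ge0.
have mh : measurable_fun setT h.
  apply/measurable_EFinP; apply: measurable_funD => //.
  by apply: measurable_funM => //; exact: measurable_sqd.
apply: (@le_lt_trans _ _ (\sum_(n <oo) \int[P]_(u in g @^-1` D n) h u)).
  apply: lee_nneseries => n *.
    by apply: integral_ge0 => u _; rewrite lee_fin mulr_ge0// sqd_ge0.
  apply: ge0_le_integral => //.
  - by move=> u _; rewrite lee_fin mulr_ge0// sqd_ge0.
  - apply: measurable_funTS; apply/measurable_EFinP; apply: measurable_funM => //.
    exact: measurable_sqd.
  - exact: measurable_funTS.
  - move=> u gu; rewrite lee_fin.
    have := sqd_le2 (f u) (g u) (c n); have := Dc _ _ gu; lra.
rewrite -ge0_integral_bigcup//; last 2 first.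
- by apply: measurable_funTS.
- apply/trivIsetP => i j _ _ ij.
  by move/trivIsetP : tD => /(_ i j I I ij) tD; rewrite -preimage_setI tD preimage_set0.
rewrite -preimage_bigcup cD preimage_setT /h.
under eq_integral do rewrite EFinD EFinM.
rewrite ge0_integralD//; last 2 first.
- by move=> u _; rewrite -EFinM lee_fin mulr_ge0// sqd_ge0.
- by apply: measurable_funeM; exact: measurable_sqdE.
rewrite ge0_integralZl_EFin//; last 2 first.
- by move=> u _; rewrite lee_fin sqd_ge0.
- exact: measurable_sqdE.
rewrite integral_cst// lte_add_pinfty//; first by rewrite lte_mul_pinfty.
apply: lte_mul_pinfty => //.
exact: le_lt_trans (probability_le1 P measurableT) (ltry _).
Qed.

(* The two plans are glued only approximately, the middle coordinates being
   required to lie in the same cell of a countable partition into sets of bounded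
   diameter: this needs no disintegration and costs only an additive constant. *)
Lemma W2sq_lty_trans (rho sigma eta : probability Rd R) :
  W2sq rho sigma < +oo -> W2sq sigma eta < +oo -> W2sq rho eta < +oo.
Proof.
move=> /ereal_inf_lt[_ [P [_ _ P1 P2] <-] Poo].
move=> /ereal_inf_lt[_ [Q [_ _ Q1 Q2] <-] Qoo].
have [D [c [mD tD cD Dc]]] := @bounded_partition R d.
have mfst : measurable_fun setT (fst : Rd * Rd -> Rd) by [].
have msnd : measurable_fun setT (snd : Rd * Rd -> Rd) by [].
have mBP n : measurable ((snd : Rd * Rd -> Rd) @^-1` D n).
  by rewrite -[X in measurable X]setTI; exact: msnd.
have mBQ n : measurable ((fst : Rd * Rd -> Rd) @^-1` D n).
  by rewrite -[X in measurable X]setTI; exact: mfst.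
have /choice[PN PNE] n := exists_cond_law P _ fst (mBP n) mfst.
have /choice[QN QNE] n := exists_cond_law Q _ snd (mBQ n) msnd.
have sD0 n : (0 <= fine (sigma (D n)))%R by exact/fine_ge0/measure_ge0.
have sDE n : (fine (sigma (D n)))%:E = sigma (D n).
  by rewrite fineK//; exact: fin_num_measure.
(* Given that the middle point lies in cell [n], an event of mass [sigma (D n)], the outer points
   are drawn independently from their conditional laws. *)
pose m n : {measure set (Rd * Rd) -> \bar R} :=
  mscale (NngNum (sD0 n)) (PN n \x QN n).
have mE n A : m n A = sigma (D n) * (PN n \x QN n) A.
  by rewrite /m /= /mscale /= sDE.
pose M0 : {measure set (Rd * Rd) -> \bar R} := mseries m 0.
have Mfst A : measurable A -> M0 (fst @^-1` A) = rho A.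
  move=> mA; rewrite /M0 /= /mseries -P1//.
  rewrite -(sum_cond_measure P snd D)//; last first.
    by rewrite -[X in measurable X]setTI; exact: mfst.
  apply: eq_eseriesr => n _; rewrite -PNE// P2// mE.
  by rewrite product_probability_fst.
have Msnd A : measurable A -> M0 (snd @^-1` A) = eta A.
  move=> mA; rewrite /M0 /= /mseries -Q2//.
  rewrite -(sum_cond_measure Q fst D)//; last first.
    by rewrite -[X in measurable X]setTI; exact: msnd.
  apply: eq_eseriesr => n _; rewrite -QNE// Q1// mE.
  by rewrite product_probability_snd.
have M1 : M0 setT = 1 by rewrite -(preimage_setT fst) Mfst// probability_setT.
(* The total mass is already 1; normalizing only supplies the probability structure. *)
pose M : probability (Rd * Rd)%type R := mnormalize M0 P.
have ME A : M A = M0 A.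
  by rewrite /M /= /mnormalize M1 onee_eq0 /= invr1 mule1.
apply: (@le_lt_trans _ _ (cost M fst snd)).
  by apply: W2sq_le; split=> // A mA; rewrite ME ?Mfst ?Msnd.
rewrite /cost (eq_measure_integral M0); last by move=> A _ _; exact: ME.
rewrite /M0 ge0_integral_measure_series//; last 2 first.
- by move=> u _; rewrite lee_fin sqd_ge0.
- exact: measurable_sqdE.
have P0 n : 0 <= \int[P]_(u in snd @^-1` D n) (2 * sqd u.1 (c n))%:E.
  by apply: integral_ge0 => u _; rewrite lee_fin mulr_ge0// sqd_ge0.
have Q0 n : 0 <= \int[Q]_(u in fst @^-1` D n) (2 * sqd u.2 (c n))%:E.
  by apply: integral_ge0 => u _; rewrite lee_fin mulr_ge0// sqd_ge0.
(* On cell [n] the outer points are compared through the centre [c n], which separates the two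
   plans. *)
apply: (@le_lt_trans _ _ (\sum_(n <oo)
   (\int[P]_(u in snd @^-1` D n) (2 * sqd u.1 (c n))%:E +
    \int[Q]_(u in fst @^-1` D n) (2 * sqd u.2 (c n))%:E))); last first.
  rewrite nneseriesD// lte_add_pinfty//.
    exact: (sum_cond_cost_lty P fst snd).
  by apply: (sum_cond_cost_lty Q snd fst) => //; rewrite costC.
apply: lee_nneseries => n *.
  by apply: integral_ge0 => u _; rewrite lee_fin sqd_ge0.
have s20 (x y : Rd) : 0 <= (2 * sqd x y)%:E by rewrite lee_fin mulr_ge0// sqd_ge0.
have ms2 dV (V : measurableType dV) (f : V -> Rd) : measurable_fun setT f ->
    measurable_fun setT (fun v => (2 * sqd (f v) (c n))%:E).
  move=> mf; apply/measurable_EFinP; apply: measurable_funM => //.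
  exact: measurable_sqd.
rewrite ge0_integral_mscale//=; last 2 first.
- exact: measurable_sqdE.
- by move=> u _; rewrite lee_fin sqd_ge0.
rewrite -(cond_law_integral P _ fst (PN n) (mBP n) mfst (PNE n)
  (fun x : Rd => (2 * sqd x (c n))%:E))//; last exact: ms2.
rewrite -(cond_law_integral Q _ snd (QN n) (mBQ n) msnd (QNE n)
  (fun x : Rd => (2 * sqd x (c n))%:E))//; last exact: ms2.
rewrite P2// Q1// sDE -ge0_muleDr; last 2 first.
- exact: integral_ge0.
- exact: integral_ge0.
apply: lee_wpmul2l => //.
rewrite (law_integral (PN n \x QN n) fst (PN n) mfst)//; last 2 first.
- by move=> A mA; apply/esym; exact: product_probability_fst.
- exact: ms2.
rewrite (law_integral (PN n \x QN n) snd (QN n) msnd)//; last 2 first.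
- by move=> A mA; apply/esym; exact: product_probability_snd.
- exact: ms2.
rewrite -ge0_integralD//; try exact: ms2.
apply: ge0_le_integral => //.
- by move=> u _; rewrite lee_fin sqd_ge0.
- exact: measurable_sqdE.
- by apply: emeasurable_funD; exact: ms2.
- by move=> u _; rewrite -EFinD lee_fin [X in (_ + 2 * X)%R]sqdC sqd_le2.
Qed.

End approximate_gluing.

(** * Real-valued squared distance on the space of measures at finite distance from [omega0] *)

Section P2_space.
Context {R : realType} {d : nat} {omega0 : probability (Rd R d) R}.
Implicit Types mu nu : probability (Rd R d) R.

(* Real-valued, hence 0 when the distance is infinite. *)
Definition rW2sq mu nu : R := fine (W2sq mu nu).

Lemma rW2sq_ge0 mu nu : 0 <= rW2sq mu nu.
Proof. exact/fine_ge0/W2sq_ge0. Qed.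

Lemma rW2sqC mu nu : rW2sq mu nu = rW2sq nu mu.
Proof. by rewrite /rW2sq W2sqC. Qed.

Lemma rW2sqE mu nu : P2 omega0 mu -> P2 omega0 nu -> W2sq mu nu = (rW2sq mu nu)%:E.
Proof.
move=> /P2P mu0 /P2P nu0; rewrite fineK// ge0_fin_numE ?W2sq_ge0//.
by apply: W2sq_lty_trans mu0 _; rewrite W2sqC.
Qed.

Lemma P2_lty mu nu : P2 omega0 mu -> (W2sq mu nu < +oo)%E -> P2 omega0 nu.
Proof.
by move=> /P2P mu0 munu; apply/P2P; apply: W2sq_lty_trans mu0; rewrite W2sqC.
Qed.

Lemma W2E mu nu : P2 omega0 mu -> P2 omega0 nu ->
  W2 mu nu = (Num.sqrt (rW2sq mu nu))%:E.
Proof. by move=> hmu hnu; rewrite /W2 (rW2sqE _ _ hmu hnu). Qed.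

End P2_space.

(** The limit as [a] tends to 0. If [y < x], the value [a = 1 / 2] gives [0 < x], and
    [a = (x - y) / (2 * x)] then turns the left side into the midpoint of [x] and [y], which exceeds
    [y]. *)
Lemma le_of_shrink {R : realFieldType} (x y : R) :
  (forall a, 0 < a < 1 -> (1 - a) * x <= y) -> x <= y.
Proof.
move=> H; have [//|yx] := leP x y.
have h1 := H (1 / 2) ltac:(lra).
have x0 : 0 < x by lra.
have a01 : 0 < (x - y) / (2 * x) < 1.
  by rewrite divr_gt0 ?subr_gt0 ?mulr_gt0//= ltr_pdivrMr ?mulr_gt0//; lra.
have := H _ a01.
have -> : (1 - (x - y) / (2 * x)) * x = (x + y) / 2 by field; lra.
lra.
Qed.

(** * Real-valued consequences of convexity along generalized geodesics *)

Section variational.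
Context {R : realType} {d : nat} {omega0 : probability (Rd R d) R}.
Context {E : probability (Rd R d) R -> \bar R} {lam : R}.
Context (E_ninfty : no_minus_infty omega0 E).
Context (E_lsc : W2_lsc omega0 E).
Context (E_convex : gg_convex omega0 E lam).
Local Notation P2 := (P2 omega0).
Local Notation domE := (domE omega0 E).
Implicit Types mu nu v m w : probability (Rd R d) R.

Lemma domE_fine mu : domE mu -> E mu = (fine (E mu))%:E.
Proof.
move=> [hmu Emu]; rewrite fineK// fin_numE (E_ninfty _ hmu) /=.
by move: Emu; rewrite lt_neqAle => /andP[].
Qed.

(** [C] is the squared distance of [mu0] and [mu1] along the three-plan, the same for all [a]. The
    last inequality is [cost_interp], since the plan couples [w] with [mua]. *)
Lemma gg_interpolation mu0 mu1 w : domE mu0 -> domE mu1 -> P2 w ->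
  exists C : R, rW2sq mu0 mu1 <= C /\
    forall a : R, 0 <= a <= 1 -> exists2 mua, domE mua &
      fine (E mua) <= (1 - a) * fine (E mu0) + a * fine (E mu1)
                      - a * (1 - a) * lam / 2 * C /\
      rW2sq w mua + a * (1 - a) * C <= (1 - a) * rW2sq w mu0 + a * rW2sq w mu1.
Proof.
move=> dmu0 dmu1 hw; have [hmu0 _] := dmu0; have [hmu1 _] := dmu1.
have [W [[[m1 m2 W1 W2] W12] [[_ m3 _ W3] W13] WE]] := E_convex _ _ _ hmu0 hmu1 hw.
have cid a (a01 : 0 <= a <= 1) := cost_interp W _ _ _ a a01 m1 m2 m3.
rewrite W12 W13 (rW2sqE _ _ hw hmu0) (rW2sqE _ _ hw hmu1) in cid.
set K := cost W (fun x => x.1.2) (fun x => x.2) in cid WE.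
have Koo : (K < +oo)%E.
  rewrite ltNge leye_eq; apply/eqP => Koo.
  (* At the midpoint an infinite [K] would make the left side of [cid] infinite, while the right
     side is finite. *)
  have := cid (1 / 2) ltac:(lra); rewrite Koo gt0_muley; last by rewrite lte_fin; lra.
  rewrite addey// -ltNye (lt_le_trans (ltNyr 0))//.
  exact: cost_ge0.
have KE : K = (fine K)%:E by rewrite fineK// ge0_fin_numE// cost_ge0.
rewrite KE in cid WE.
exists (fine K); split.
  rewrite -lee_fin -KE -(rW2sqE _ _ hmu0 hmu1).
  by apply: W2sq_le; split.
move=> a a01.
have mi := measurable_interp _ _ (1 - a) a m2 m3.
have [mua muaE] := exists_law W _ mi.
have Wle : (W2sq w mua <= cost W (fun x => x.1.1) (fun x =>
    (1 - a) *: (x.1.2 : 'rV[R]_d) + a *: (x.2 : 'rV[R]_d))%R)%E.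
  by apply: W2sq_le; split => // A mA; rewrite muaE.
have cle : (W2sq w mua + (a * (1 - a) * fine K)%:E <=
    ((1 - a) * rW2sq w mu0 + a * rW2sq w mu1)%:E)%E.
  by rewrite EFinD !(EFinM _ (rW2sq _ _)) -cid// EFinM leeD2r.
have hmua : P2 mua.
  apply: (P2_lty w) => //; rewrite ltNge leye_eq; apply/eqP => Woo.
  by rewrite Woo in cle.
have Ele := WE a a01 mua (fun A mA => muaE A).
rewrite (domE_fine _ dmu0) (domE_fine _ dmu1) in Ele.
have dmua : domE mua.
  by split => //; apply: le_lt_trans Ele _; rewrite -!EFinM -EFinN -!EFinD ltry.
exists mua => //; split.
  by rewrite -lee_fin -(domE_fine _ dmua) !EFinD EFinN !EFinM -?EFinM in Ele *.
by rewrite -lee_fin EFinD -(rW2sqE _ _ hw hmua).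
Qed.

(** A weighted squared triangle inequality through [w], obtained by dropping the distance from [w]
    to the interpolant. *)
Lemma rW2sq_interpolation mu0 mu1 w (k : R) : domE mu0 -> domE mu1 -> P2 w ->
  0 <= k <= 1 ->
  k * (1 - k) * rW2sq mu0 mu1 <= (1 - k) * rW2sq w mu0 + k * rW2sq w mu1.
Proof.
move=> dmu0 dmu1 hw k01.
have [C [wC /(_ k k01)[mua _ [_ H]]]] := gg_interpolation _ _ _ dmu0 dmu1 hw.
apply: le_trans _ H; rewrite -[leLHS]add0r lerD ?rW2sq_ge0// ler_wpM2l//.
by rewrite mulr_ge0//; lra.
Qed.

(** With base [mu] itself the generalized geodesic is a true one: the distance inequality gives
    [(1 - b) * C <= rW2sq mu v] for small [b], so [C] is the squared distance. *)
Lemma geodesic_interpolation mu v (a : R) : domE mu -> domE v -> 0 <= a <= 1 ->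
  exists2 mua, domE mua &
    fine (E mua) <= (1 - a) * fine (E mu) + a * fine (E v)
                    - a * (1 - a) * lam / 2 * rW2sq mu v /\
    rW2sq mu mua <= a ^+ 2 * rW2sq mu v.
Proof.
move=> dmu dv a01; have [hmu _] := dmu.
have [C [wC HC]] := gg_interpolation _ _ _ dmu dv hmu.
have w0 : rW2sq mu mu = 0 by rewrite /rW2sq W2sqxx.
have Cw : C = rW2sq mu v.
  apply/eqP; rewrite eq_le wC andbT; apply: le_of_shrink => b /andP[b0 b1].
  have [|mub _ [_]] := HC b; first by rewrite !ltW.
  rewrite w0 mulr0 add0r => H; have h0 := rW2sq_ge0 mu mub.
  have : b * (1 - b) * C <= b * rW2sq mu v by lra.
  by rewrite -mulrA ler_pM2l.
have [mua dmua [Ha Hw]] := HC a a01; exists mua => //; rewrite -Cw; split => //.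
move: Hw; rewrite w0 -Cw; lra.
Qed.

(** Used in place of the separation of points by the distance: [v] lies in every ball around [mu],
    so semicontinuity at level [E v] would give [E v < E v]. *)
Lemma lsc_W2sq0 mu v : domE mu -> domE v -> rW2sq mu v = 0 ->
  fine (E mu) <= fine (E v).
Proof.
move=> dmu dv w0; have [hmu _] := dmu; have [hv _] := dv.
rewrite leNgt; apply/negP => Ev.
have [|delta [d0 H]] := E_lsc _ hmu (fine (E v)).
  by rewrite (domE_fine _ dmu) lte_fin.
have := H v hv; rewrite (W2E _ _ hmu hv) w0 sqrtr0 lte_fin => /(_ d0).
by rewrite {2}(domE_fine _ dv) ltxx.
Qed.

(** * From the local slope to a global energy bound *)

Lemma slope_ge0 mu : (0 <= metric_slope omega0 E mu)%E.
Proof.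
apply: le_ereal_inf_tmp => _ [r _ <-].
by apply: ereal_sup_ubound; left.
Qed.

(** Along the geodesic to [v], the energy drops by at least [a * (X - a * (lam / 2 * W ^+ 2))] over
    a distance at most [a * W]. A slope below [X / W] is contradicted for small [a]. *)
Lemma slope_bound mu v : dom_slope omega0 E mu -> domE v ->
  fine (E mu) - fine (E v) <=
    fine (metric_slope omega0 E mu) * Num.sqrt (rW2sq mu v) - lam / 2 * rW2sq mu v.
Proof.
move=> [dmu Soo] dv; have [hmu _] := dmu; have [hv _] := dv.
have SE : metric_slope omega0 E mu = (fine (metric_slope omega0 E mu))%:E.
  by rewrite fineK// ge0_fin_numE// slope_ge0.
set S := fine _ in SE *; set W := Num.sqrt _.
have W0 : 0 <= W by exact: sqrtr_ge0.
have WW : rW2sq mu v = W ^+ 2 by rewrite sqr_sqrtr// rW2sq_ge0.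
rewrite leNgt; apply/negP; rewrite WW => SX.
have [{}W0|W0'] := eqVneq W 0.
  have := lsc_W2sq0 _ _ dmu dv; rewrite WW W0 expr0n => /(_ erefl).
  by move: SX; rewrite W0 expr0n /=; lra.
have {W0 W0'} W0 : 0 < W by rewrite lt_def W0'.
set X := fine (E mu) - fine (E v) + lam / 2 * W ^+ 2.
have SX' : S < X / W by rewrite ltr_pdivlMr// /X; lra.
have /ereal_inf_lt[_ [r /= r0 <-]] : (metric_slope omega0 E mu < (X / W)%:E)%E.
  by rewrite SE lte_fin.
set T := ereal_sup _ => TX.
have T0 : (0 <= T)%E by apply: ereal_sup_ubound; left.
have TE : T = (fine T)%:E.
  by rewrite fineK// ge0_fin_numE// (lt_trans TX)// ltry.
set t := fine T in TE.
have t0 : 0 <= t by rewrite fine_ge0.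
have tX : t * W < X by rewrite -ltr_pdivlMr// -lte_fin -TE.
(* Small enough for [mua] to lie within radius [r] and for the quadratic correction not to consume
   the gap [X - t * W]. The [+ 1] in [L] keeps the divisor positive. *)
have [a [a0 a1 aW aX]] : exists a, [/\ 0 < a, a < 1, a * W < r &
    t * W < X - a * (lam / 2 * W ^+ 2)].
  pose L := `|lam / 2 * W ^+ 2| + 1.
  have L0 : 0 < L by rewrite ltr_wpDl.
  pose a := Num.min (1 / 2) (Num.min (r / (2 * W)) ((X - t * W) / (2 * L))).
  have a0 : 0 < a.
    by rewrite !lt_min !divr_gt0// ?mulr_gt0// subr_gt0.
  have a1 : a <= 1 / 2 by rewrite ge_min lexx.
  have a2 : a <= r / (2 * W) by rewrite !ge_min lexx ?orbT.
  have a3 : a <= (X - t * W) / (2 * L) by rewrite !ge_min lexx ?orbT.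
  exists a; split => //; first by lra.
    move: a2; rewrite ler_pdivlMr ?mulr_gt0// => a2.
    by have := mulr_gt0 a0 W0; lra.
  move: a3; rewrite ler_pdivlMr ?mulr_gt0// => a3.
  have : a * (lam / 2 * W ^+ 2) <= a * L.
    by rewrite ler_pM2l// /L (le_trans (ler_norm _))// lerDl.
  by have := mulr_gt0 a0 L0; lra.
have [|mua dmua [Ea wa]] := geodesic_interpolation mu v a dmu dv.
  by rewrite !ltW.
have [hmua _] := dmua.
set u := Num.sqrt (rW2sq mu mua).
have uaW : u <= a * W.
  have aW0 : 0 <= a * W by rewrite mulr_ge0 ?ltW.
  by rewrite -(ger0_norm aW0) -sqrtr_sqr ler_wsqrtr// exprMn -WW.
have Egap : a * (t * W) < fine (E mu) - fine (E mua).
  rewrite WW in Ea.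
  have : a * (t * W) < a * (X - a * (lam / 2 * W ^+ 2)) by rewrite ltr_pM2l.
  by rewrite /X; lra.
have tW0 : 0 <= a * (t * W) by rewrite !mulr_ge0// ltW.
(* The slope only tests points at positive distance; at distance zero [lsc_W2sq0] would contradict
   [Egap]. *)
have u0 : 0 < u.
  rewrite lt_def sqrtr_ge0 andbT; apply/eqP => u0.
  have : rW2sq mu mua = 0 by rewrite -[LHS]sqr_sqrtr ?rW2sq_ge0// -/u u0 expr0n.
  by move=> /(lsc_W2sq0 _ _ dmu dmua); lra.
have : (((fine (E mu) - fine (E mua)) / u)%:E <= T)%E.
  apply: ereal_sup_ubound; right; exists mua.
    by split => //; rewrite (W2E _ _ hmu hmua) !lte_fin u0 (le_lt_trans uaW).
  rewrite (W2E _ _ hmu hmua) (domE_fine _ dmu) (domE_fine _ dmua) -EFinB /=.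
  rewrite EFinM; congr (_ * _)%E; rewrite -EFin_max; congr EFin.
  by apply/max_idPl; lra.
rewrite TE lee_fin ler_pdivrMr// => H.
have : t * u <= t * (a * W) by rewrite ler_wpM2l.
lra.
Qed.

(** * Minimizers of one proximal step *)

Section resolvent.
Context {tau : R} (tau0 : 0 < tau) (k0 : 0 < 1 + lam * tau).

Lemma JKO_le mu m v : P2 mu -> is_JKO omega0 E tau mu m -> domE v ->
  domE m /\ rW2sq mu m + 2 * tau * fine (E m) <= rW2sq mu v + 2 * tau * fine (E v).
Proof.
move=> hmu [hm Hm] dv; have [hv _] := dv.
have := Hm v hv; rewrite (rW2sqE _ _ hmu hm) (rW2sqE _ _ hmu hv).
rewrite (domE_fine _ dv) -EFinM => H.
have dm : domE m.
  split=> //; rewrite ltNge leye_eq; apply/eqP => Em.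
  by move: H; rewrite Em -!EFinM -EFinD addey.
split=> //; move: H; rewrite (domE_fine _ dm) -!EFinM -!EFinD lee_fin.
have t2 : 0 < 2 * tau by rewrite mulr_gt0.
rewrite -(ler_pM2l t2) !mulrDr !mulrA divff ?mul1r//.
by rewrite gt_eqF.
Qed.

(** Test minimality of [m] against the point [mua] of the geodesic from [m] to [v] with base [mu],
    divide by [a], and let [a] tend to 0. Positivity of [1 + lam * tau] lets [C] replace the smaller
    [rW2sq m v]. *)
Lemma discrete_variational_inequality mu m v : P2 mu ->
  is_JKO omega0 E tau mu m -> domE v ->
  (1 + lam * tau) * rW2sq m v <=
    rW2sq mu v - rW2sq mu m + 2 * tau * (fine (E v) - fine (E m)).
Proof.
move=> hmu Jm dv.
have [dm _] := JKO_le _ _ _ hmu Jm dv.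
have [C [wC HC]] := gg_interpolation _ _ _ dm dv hmu.
apply: (@le_trans _ _ ((1 + lam * tau) * C)); first by rewrite ler_pM2l.
apply: le_of_shrink => a /andP[a0 a1].
have [|mua dmua [Ha Hw]] := HC a; first by rewrite !ltW.
have [_ H] := JKO_le _ _ _ hmu Jm dmua.
have H2 : 2 * tau * fine (E mua) <= 2 * tau * ((1 - a) * fine (E m) + a * fine (E v)
                      - a * (1 - a) * lam / 2 * C).
  by rewrite ler_pM2l// mulr_gt0.
rewrite -(ler_pM2l a0); lra.
Qed.

End resolvent.
End variational.

(** * Algebraic combination of the inequalities *)

Section real_inequalities.
Context {R : realFieldType}.
(* a, b, c, e and W ^+ 2 are the squared distances between (Jmu, Jnu),
   (mu, Jnu), (mu, nu), (nu, Jnu) and (mu, Jmu); s is tau times the slope at mu;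
   p and q are 2 tau times the energy drops from mu to Jmu and to Jnu. *)
Context {k a b c e W s p q : R}.
Context (dvi_mu : k * a <= b - W ^+ 2 + (p - q)).
Context (dvi_nu : k * b <= c - e + q).
Context (slope_mu : p <= 2 * s * W - (k - 1) * W ^+ 2).

(** Add [k] times each of the three inequalities: [q] cancels, [tri] absorbs [b] and [e], and
    [2 * s * (k * W) - (k * W) ^+ 2] is at most [s ^+ 2]. *)
Lemma almost_contraction_nonpos : 0 < k ->
  k * (1 - k) * b <= (1 - k) * c + k * e -> k ^+ 2 * a <= c + s ^+ 2.
Proof.
move=> k0 tri.
have /= h1 := ler_wpM2l (ltW k0) dvi_mu.
have /= h2 := ler_wpM2l (ltW k0) dvi_nu.
have /= h3 := ler_wpM2l (ltW k0) slope_mu.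
have := sqr_ge0 (s - k * W); lra.
Qed.

(** Adding [k * dvi_mu] and [dvi_nu] cancels [b] and leaves [p + (k - 1) * (p - q)]; the first term
    is bounded by the slope, the second by [D]. *)
Lemma almost_contraction_pos (D : R) : 1 <= k -> 0 <= e ->
  (k - 1) * (p - q) <= D -> k ^+ 2 * a <= c + s ^+ 2 + D.
Proof.
move=> k1 e0 pqD; have k0 : 0 < k by lra.
have /= h1 := ler_wpM2l (ltW k0) dvi_mu.
have := sqr_ge0 (s - W).
have : 0 <= (k - 1) * W ^+ 2 by rewrite mulr_ge0 ?sqr_ge0//; lra.
move: dvi_nu slope_mu; lra.
Qed.

End real_inequalities.

(** * The estimates in extended real form *)

Theorem theorem2p1 (R : realType) (d : nat) (omega0 : probability (Rd R d) R)
  (E : probability (Rd R d) R -> \bar R) (lam : R) :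
  no_minus_infty omega0 E ->
  E_proper omega0 E -> E_coercive omega0 E -> W2_lsc omega0 E ->
  gg_convex omega0 E lam ->
  forall (mu nu : probability (Rd R d) R),
  dom_slope omega0 E mu -> closure_domE omega0 E nu ->
  forall tau : R, 0 < tau -> (tau%:E < inv_lambda_minus lam)%E ->
  forall Jmu Jnu : probability (Rd R d) R,
  is_JKO omega0 E tau mu Jmu -> is_JKO omega0 E tau nu Jnu ->
  (0 < lam ->
    (((1 + lam * tau) ^+ 2)%:E * W2sq Jmu Jnu
      <= W2sq mu nu + (tau ^+ 2)%:E * (metric_slope omega0 E mu * metric_slope omega0 E mu)
         + (2 * lam * tau ^+ 2)%:E * (E nu - infE omega0 E))%E) /\
  (lam <= 0 ->
    (((1 + lam * tau) ^+ 2)%:E * W2sq Jmu Jnu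
      <= W2sq mu nu + (tau ^+ 2)%:E * (metric_slope omega0 E mu * metric_slope omega0 E mu))%E).
Proof.
move=> E_ninfty _ _ E_lsc E_convex mu nu smu [hnu _] tau tau0 taulam.
move=> Jmu Jnu JJmu JJnu.
have [dmu Soo] := smu; have [hmu _] := dmu.
have k0 : 0 < 1 + lam * tau.
  move: taulam; rewrite /inv_lambda_minus; case: ifPn => [lam0 _|].
    by rewrite ltr_wpDr// mulr_ge0// ltW.
  rewrite -ltNge => lam0; rewrite lte_fin -[ltRHS]div1r ltr_pdivlMr ?oppr_gt0//.
  lra.
have [dJmu _] := JKO_le E_ninfty tau0 _ _ _ hmu JJmu dmu.
have [dJnu _] := JKO_le E_ninfty tau0 _ _ _ hnu JJnu dmu.
have [hJmu _] := dJmu; have [hJnu _] := dJnu.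
have dvi_mu := discrete_variational_inequality E_ninfty E_convex tau0 k0
  _ _ _ hmu JJmu dJnu.
have dvi_nu := discrete_variational_inequality E_ninfty E_convex tau0 k0
  _ _ _ hnu JJnu dmu.
have slope_mu := slope_bound E_ninfty E_lsc E_convex _ _ smu dJmu.
rewrite (rW2sqC Jnu) (rW2sqC nu mu) in dvi_nu.
have SE : metric_slope omega0 E mu = (fine (metric_slope omega0 E mu))%:E.
  by rewrite fineK// ge0_fin_numE// slope_ge0.
rewrite SE (rW2sqE _ _ hmu hnu) (rW2sqE _ _ hJmu hJnu) -!EFinM -EFinD.
set S := fine (metric_slope _ _ _) in slope_mu *.
have WW : rW2sq mu Jmu = Num.sqrt (rW2sq mu Jmu) ^+ 2 by rewrite sqr_sqrtr// rW2sq_ge0.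
set W := Num.sqrt _ in slope_mu WW; rewrite WW in dvi_mu slope_mu.
pose p := 2 * tau * (fine (E mu) - fine (E Jmu)).
pose q := 2 * tau * (fine (E mu) - fine (E Jnu)).
have {}slope_mu : p <= 2 * (tau * S) * W - (1 + lam * tau - 1) * W ^+ 2.
  have t2 : 0 < 2 * tau by rewrite mulr_gt0.
  by move: slope_mu; rewrite -(ler_pM2l t2) /p; lra.
have {}dvi_mu : (1 + lam * tau) * rW2sq Jmu Jnu <= rW2sq mu Jnu - W ^+ 2 + (p - q).
  by move: dvi_mu; rewrite /p /q; lra.
have {}dvi_nu : (1 + lam * tau) * rW2sq mu Jnu <= rW2sq mu nu - rW2sq nu Jnu + q.
  by move: dvi_nu; rewrite /q; lra.
have sS : tau ^+ 2 * (S * S) = (tau * S) ^+ 2 by ring.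
rewrite sS; split=> lam0.
- have infle : (infE omega0 E <= E Jmu)%E by apply: ereal_inf_lbound; exists Jmu.
  have infoo : (infE omega0 E < +oo)%E by apply: le_lt_trans infle dJmu.2.
  have c0 : 0 < 2 * lam * tau ^+ 2 by rewrite !mulr_gt0.
  (* Since [nu] is only in the closure of the domain, [E nu] may be infinite; this and an infimum
     equal to [-oo] make the claim trivial. *)
  have rhs_oo : (E nu - infE omega0 E = +oo ->
    ((1 + lam * tau) ^+ 2 * rW2sq Jmu Jnu)%:E <=
    (rW2sq mu nu + (tau * S) ^+ 2)%:E + (2 * lam * tau ^+ 2)%:E * (E nu - infE omega0 E))%E.
    by move=> ->; rewrite gt0_muley ?lte_fin// addey// leey.
  have [Enuoo|Enu] := eqVneq (E nu) +oo%E.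
    apply: rhs_oo; rewrite Enuoo addye//.
    by rewrite eqe_oppLR /= lt_eqF.
  have dnu : domE omega0 E nu by split=> //; rewrite ltey.
  have [infNoo|infN] := eqVneq (infE omega0 E) -oo%E.
    by apply: rhs_oo; rewrite infNoo (domE_fine E_ninfty _ dnu) addey.
  have infE' : infE omega0 E = (fine (infE omega0 E))%:E.
    by rewrite fineK// fin_numE infN lt_eqF.
  rewrite infE' (domE_fine E_ninfty _ dJmu) lee_fin in infle.
  rewrite (domE_fine E_ninfty _ dnu) infE' -EFinB -EFinM -EFinD lee_fin.
  (* Testing [Jnu] against [nu] itself gives [E Jnu <= E nu]. *)
  have [_] := JKO_le E_ninfty tau0 _ _ _ hnu JJnu dnu.
  rewrite {2}/rW2sq W2sqxx /= => Jle.
  have e0 := rW2sq_ge0 nu Jnu.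
  apply: (almost_contraction_pos dvi_mu dvi_nu slope_mu) => //.
    by rewrite lerDl mulr_ge0 ?ltW.
  have Ele : fine (E Jnu) <= fine (E nu).
    have t2 : 0 < 2 * tau by rewrite mulr_gt0.
    by rewrite -(ler_pM2l t2); lra.
  have -> : (1 + lam * tau - 1) * (p - q) =
      2 * lam * tau ^+ 2 * (fine (E Jnu) - fine (E Jmu)) by rewrite /p /q; ring.
  by rewrite ler_pM2l//; lra.
- rewrite lee_fin; apply: (almost_contraction_nonpos dvi_mu dvi_nu slope_mu k0).
  have lt0 : lam * tau <= 0 by rewrite mulr_le0_ge0// ltW.
  (* The weight [1 + lam * tau] lies in the unit interval because [lam <= 0]. *)
  have := rW2sq_interpolation E_ninfty E_convex mu Jnu nu (1 + lam * tau) dmu dJnu hnu.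
  rewrite (rW2sqC nu mu) => /(_ _)/wrap[|//].
  by rewrite ltW//=; lra.
Qed.
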